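(* Let $f:(\mathbb{C},0)\to(\mathbb{C},0)$ be a germ of a holomorphic diffeomorphism with an attracting hyperbolic fixed point at the origin, i.e. $f(z)=a_1z+\sum_{j\ge2}a_jz^j$ with $0<|a_1|<1$. Let $S^f(z_0)=\{f^{\circ n}(z_0):n\in\mathbb{N}_0\}$ be any orbit with initial point $z_0$ sufficiently close to $0$. Then $\dim_B(S^f(z_0))=0$.
   Context: $\dim_B$ is the box (Minkowski) dimension in $\mathbb{C}\cong\mathbb{R}^2$: with $U_\varepsilon$ the $\varepsilon$-neighborhood of a bounded set $U$ and $|U_\varepsilon|$ its area, the upper (lower) box dimension is the infimum of $s\ge0$ such that $\limsup_{\varepsilon\to0}|U_\varepsilon|/\varepsilon^{2-s}=0$ (respectively $\liminf_{\varepsilon\to0}|U_\varepsilon|/\varepsilon^{2-s}=0$); $\dim_B U$ is their common value when they coincide. *)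

(* Defs.v *)
From HB Require Import structures.
From mathcomp Require Import all_boot all_order all_algebra.
From mathcomp Require Import all_classical all_reals all_analysis.
From mathcomp Require Import complex.

Set Implicit Arguments.
Unset Strict Implicit.
Unset Printing Implicit Defensive.

Import Order.TTheory GRing.Theory Num.Theory.
Import numFieldNormedType.Exports.

Local Open Scope classical_set_scope.
Local Open Scope ring_scope.
Local Open Scope complex_scope.

(* R[i] with the topology of its modulus, as a normed space over itself: with
   this instance [derivable f z 1] is complex differentiability of f at z. *)
HB.instance Definition _ (R : realType) := NormedModule.copy R[i] R[i]^o.

(* Germs at 0 are represented by total functions on R[i]; only the values near
   0 are constrained. *)
Definition holomorphic_near0 (R : realType) (f : R[i] -> R[i]) : Prop :=
  \forall z \near (0 : R[i]), derivable f z 1.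

Definition holomorphic_diffeo_germ (R : realType) (f : R[i] -> R[i]) : Prop :=
  [/\ f 0 = 0, holomorphic_near0 f &
      exists g : R[i] -> R[i],
        [/\ g 0 = 0, holomorphic_near0 g,
            \forall z \near (0 : R[i]), g (f z) = z &
            \forall z \near (0 : R[i]), f (g z) = z]].

Definition orbit_set (R : realType) (f : R[i] -> R[i]) (z0 : R[i]) : set R[i] :=
  [set iter n f z0 | n in [set: nat]].

Definition eps_nbhd (R : realType) (U : set R[i]) (e : R) : set R[i] :=
  [set z | exists2 u, U u & `|z - u| < e%:C].

(* Two-dimensional Lebesgue measure, through x + i y |-> (x, y). *)
Definition area (R : realType) (U : set R[i]) : \bar R :=
  (@lebesgue_measure R \x @lebesgue_measure R)%E
    [set p : R * R | U (p.1 +i* p.2)].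

Definition area_ratio (R : realType) (U : set R[i]) (s e : R) : \bar R :=
  (area (eps_nbhd U e) / (e `^ (2 - s))%:E)%E.

Definition upper_box_dim (R : realType) (U : set R[i]) : \bar R :=
  ereal_inf [set s%:E | s in
    [set s : R | 0 <= s /\ limf_esup (area_ratio U s) 0^'+ = 0%E]].

Definition lower_box_dim (R : realType) (U : set R[i]) : \bar R :=
  ereal_inf [set s%:E | s in
    [set s : R | 0 <= s /\ limf_einf (area_ratio U s) 0^'+ = 0%E]].

Definition has_box_dim (R : realType) (U : set R[i]) (d : \bar R) : Prop :=
  upper_box_dim U = d /\ lower_box_dim U = d.

(* Main.v *)
(* Near 0 the power series gives |f z - a_1 z| <= C |z|^2, so |f z| <= l |z| for
   any l in ]|a_1|, 1[, and an orbit decays geometrically: |z_n| <= r l^n.  Hence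
   all but N = O(log (1/e)) points of the orbit are within e of 0, its
   e-neighborhood is covered by N + 1 squares of side 4e, and
   area / e^(2 - s) <= 16 (N + 1) e^s, which tends to 0 for every s > 0. *)
Require Import Defs.
From HB Require Import structures.
From mathcomp Require Import all_boot all_order all_algebra.
From mathcomp Require Import all_classical all_reals all_analysis.
From mathcomp Require Import complex.
From mathcomp Require Import measurable_realfun ring lra.

Set Implicit Arguments.
Unset Strict Implicit.
Unset Printing Implicit Defensive.

Import Order.TTheory GRing.Theory Num.Theory.
Import numFieldNormedType.Exports.

Local Open Scope classical_set_scope.
Local Open Scope ring_scope.
Local Open Scope complex_scope.

(** * Measurability of discs and limits at [0^'+] *)

(** For [e > 0] the disc is a strict sublevel set of a quadratic polynomial in the two coordinates;
    otherwise it is empty. *)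
Lemma measurable_disc (R : realType) (c : R[i]) (e : R) :
  measurable [set p : R * R | `|(p.1 +i* p.2) - c| < e%:C].
Proof.
have [e0|e0] := leP e 0.
  rewrite [X in measurable X](_ : _ = set0)//; apply/seteqP; split => // p /=.
  by rewrite normc_def ltcR => /(le_lt_trans (sqrtr_ge0 _)); rewrite ltNge e0.
pose g (p : R * R) := (p.1 - complex.Re c) ^+ 2 + (p.2 - complex.Im c) ^+ 2.
have gE p : (`|(p.1 +i* p.2) - c| < e%:C) = (g p < e ^+ 2).
  rewrite normc_def ltcR -[X in _ < X](ger0_norm (ltW e0)) -sqrtr_sqr ltr_sqrt ?exprn_gt0//.
  by rewrite /g; case: c {g} => a b.
rewrite [X in measurable X](_ : _ = [set p | g p < e ^+ 2]); last first.
  by apply/seteqP; split => p; rewrite /mkset gE.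
have mg : measurable_fun setT g.
  by apply: measurable_funD; apply: measurable_funX; apply: measurable_funB.
have := mg measurableT _ (measurable_itv `]-oo, e ^+ 2[).
by rewrite setTI set_itvE.
Qed.

(** The set where [g e <= d] belongs to the filter, and the supremum of [g] over it is at most
    [d]. *)
Lemma limf_esup_near0 (R : realType) (g : R -> \bar R) : (forall e, 0 <= g e)%E ->
  (forall d : R, 0 < d -> \forall e \near 0^'+, (g e <= d%:E)%E) ->
  limf_esup g 0^'+ = 0%E.
Proof.
move=> g0 gd; apply/eqP; rewrite eq_le limf_esup_ge0 ?andbT//.
apply/lee_addgt0Pr => d d0; rewrite add0e.
apply: ge_ereal_inf.
exists (ereal_sup (g @` [set e | (g e <= d%:E)%E])).
  by exists [set e | (g e <= d%:E)%E] => //; exact: gd.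
by apply: ge_ereal_sup => _ [e /= ge <-].
Qed.

(** Every set of the filter meets the set where [g e <= d], so the infimum of [g] over it is at most
    [d]. *)
Lemma limf_einf_near0 (R : realType) (g : R -> \bar R) : (forall e, 0 <= g e)%E ->
  (forall d : R, 0 < d -> \forall e \near 0^'+, (g e <= d%:E)%E) ->
  limf_einf g 0^'+ = 0%E.
Proof.
move=> g0 gd; rewrite limf_einfE; apply/eqP; rewrite eq_le; apply/andP; split.
  apply: ge_ereal_sup => _ [V /= FV <-].
  apply/lee_addgt0Pr => d d0; rewrite add0e.
  have [e [Ve ge]] := filter_ex (filterI FV (gd d d0)).
  by apply: ge_ereal_inf; exists (g e) => //; exists e.
apply: le_ereal_sup_tmp; exists (ereal_inf (g @` setT)).
  by exists setT => //; exact: filterT.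
by apply: le_ereal_inf_tmp => _ [e _ <-].
Qed.

(** * Covering a neighborhood by squares and counting them *)

Lemma eps_nbhd_range (R : realType) (u : nat -> R[i]) (e : R) :
  [set p : R * R | eps_nbhd [set u n | n in [set: nat]] e (p.1 +i* p.2)] =
  \bigcup_n [set p : R * R | `|(p.1 +i* p.2) - u n| < e%:C].
Proof.
apply/seteqP; split => p /=; first by move=> [_ [n _ <-]] h; exists n.
by move=> [n _ h]; exists (u n) => //; exists n.
Qed.

Lemma disc_sub_square (R : realType) (c : R[i]) (r : R) :
  [set p : R * R | `|(p.1 +i* p.2) - c| < r%:C] `<=`
  ball (complex.Re c) r `*` ball (complex.Im c) r.
Proof.
case: c => a b [x y]; rewrite /mkset normc_def ltcR /= => h.
have h1 (s t : R) : `|s| <= Num.sqrt (s ^+ 2 + t ^+ 2).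
  by rewrite -sqrtr_sqr ler_sqrt ?addr_ge0 ?sqr_ge0// lerDl sqr_ge0.
split; rewrite /= -ball_normE /= distrC.
  exact: le_lt_trans (h1 _ _) h.
by apply: le_lt_trans h; rewrite [_ ^+ 2 + _]addrC; exact: h1.
Qed.

(** The discs around the first [N] points are covered one by one. A point within [e] of a tail point
    is within [2 * e] of 0, so one further square, centered at 0, covers all the other discs. *)
Lemma area_eps_nbhd_range (R : realType) (u : nat -> R[i]) (e : R) (N : nat) : 0 < e ->
  (forall n, (N <= n)%N -> `|u n| < e%:C) ->
  (area (eps_nbhd [set u n | n in [set: nat]] e) <=
     (N.+1%:R * (16 * e ^+ 2))%:E)%E.
Proof.
move=> e0 uN; rewrite /area eps_nbhd_range.
(* Index [N] carries the square at the origin, which makes [N.+1] squares in all. *)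
pose v n : R[i] := if (n < N)%N then u n else 0.
pose Q n : set (R * R) :=
  ball (complex.Re (v n)) (2 * e) `*` ball (complex.Im (v n)) (2 * e).
have mQ n : measurable (Q n) by apply: measurableX; exact: measurable_ball.
apply: (@le_trans _ _ (\sum_(k < N.+1) (@lebesgue_measure R \x @lebesgue_measure R)%E (Q k))%E).
  apply: content_subadditive => //; first by move=> k _; exact: mQ.
    by apply: bigcupT_measurable => n; exact: measurable_disc.
  rewrite -bigcup_mkord => p [n _ /= pn].
  have [nN|Nn] := ltnP n N.
    exists n; first by rewrite /= ltnS ltnW.
    apply: disc_sub_square; rewrite /mkset /v nN; apply: lt_trans pn _.
    by rewrite ltcR ltr_pMl// ltr1n.
  exists N => //=; apply: disc_sub_square; rewrite /mkset /v ltnn subr0.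
  rewrite -[X in `|X|](subrK (u n)); apply: le_lt_trans (ler_normD _ _) _.
  by rewrite mulr_natl mulr2n rmorphD ltrD//; exact: uN.
have QE k : ((@lebesgue_measure R \x @lebesgue_measure R)%E (Q k) = (16 * e ^+ 2)%:E)%E.
  transitivity (@lebesgue_measure R (ball (complex.Re (v k)) (2 * e)) *
                @lebesgue_measure R (ball (complex.Im (v k)) (2 * e)))%E.
    by apply: product_measure1E; exact: measurable_ball.
  rewrite !lebesgue_measure_ball ?mulr_ge0 ?(ltW e0)// -EFinM; congr EFin.
  by rewrite -mulr_natr; ring.
under eq_bigr do rewrite QE.
by rewrite sumEFin sumr_const card_ord lee_fin -[X in X <= _]mulr_natl.
Qed.

(* The least such [N] is about [(ln r - ln e) / - ln l], and [ln x < x] at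
   [x = e `^ (- s / 2)] gives [- ln e <= e `^ (- s / 2) / (s / 2)]. *)
Lemma near0_geometric_count (R : realType) (l r s d : R) :
  0 < l < 1 -> 0 < r -> 0 < s -> 0 < d ->
  \forall e \near 0^'+, exists2 N, r * l ^+ N < e & N.+1%:R * e `^ s <= d.
Proof.
move=> /andP[l0 l1] r0 s0 d0.
have L0 : 0 < - ln l by rewrite oppr_gt0 ln_lt0// l0.
pose t := s / 2; have t0 : 0 < t by rewrite divr_gt0.
pose h (e : R) := (ln r / - ln l + 2) * e `^ s + (t * - ln l)^-1 * e `^ t.
have h0 : h e @[e --> 0^'+] --> 0.
  rewrite [X in _ --> X](_ : 0 = (ln r / - ln l + 2) * 0 + (t * - ln l)^-1 * 0); last by ring.
  by apply: cvgD; apply: cvgM; [exact: cvg_cst|exact: powR_cvg0|exact: cvg_cst|exact: powR_cvg0].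
near=> e.
have e0 : 0 < e by near: e; exact: nbhs_right_gt.
(* This makes [x] nonnegative, as the lower bound on [x] by its truncation requires. *)
have er : e <= r by near: e; exact: nbhs_right_le.
pose x := (ln r - ln e) / - ln l.
have x0 : 0 <= x by rewrite divr_ge0 ?(ltW L0)// subr_ge0 ler_ln ?posrE.
have hd : h e <= d by near: e; exact: (cvgr_le _ h0).
(* The successor exceeds [x], which gives the strict inequality, and [N.+1 <= x + 2]. *)
exists (Num.truncn x).+1.
  rewrite -ltr_ln ?posrE ?mulr_gt0 ?exprn_gt0// lnM ?posrE ?exprn_gt0// lnXn//.
  have := truncnS_gt x; rewrite ltr_pdivrMr// mulrN mulr_natl; lra.
apply: le_trans hd.
have /andP[xl _] := truncn_itv x0.
have lt_x : ln e * - t <= e `^ (- t).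
  by rewrite mulrC -ln_powR ltW// ln_sublinear// powR_gt0.
have xle : x <= ln r / - ln l + (t * - ln l)^-1 * e `^ (- t).
  rewrite /x mulrDl lerD2l invfM mulrAC ler_pM2r ?invr_gt0//.
  by rewrite ler_pdivlMl//; lra.
have -> : h e = (ln r / - ln l + (t * - ln l)^-1 * e `^ (- t) + 2) * e `^ s.
  rewrite /h (_ : e `^ s = e `^ t * e `^ t); last first.
    by rewrite -powRD ?gt_eqF ?implybT// -splitr.
  have := powRN e t; have := powR_gt0 t e0.
  move: (e `^ t) (e `^ - t) => u _ u0 ->; field.
  by rewrite -[ln l]opprK oppr_eq0 !gt_eqF.
rewrite ler_pM2r ?powR_gt0// -[_.+2]addn2 natrD; lra.
Unshelve. all: by end_near.
Qed.

(** * From the power series to contraction near 0 *)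

Lemma bounded_fun_norm_le (K : numFieldType) (V : normedModType K) (u : nat -> V) :
  bounded_fun u -> exists2 M : K, 0 < M & forall n, `|u n| <= M.
Proof.
move=> /ex_strict_bound_gt0 [M M0 h]; exists M => // n; apply: ltW; exact: h.
Qed.

Lemma near0_normP (K : numFieldType) (V : normedModType K) (P : V -> Prop) :
  (\forall z \near (0 : V), P z) <-> exists2 r : K, 0 < r & forall z, `|z| < r -> P z.
Proof.
split=> [/nbhs_normP[r /= r0 h]|[r r0 h]].
  by exists r => // z zr; apply: h; rewrite /= sub0r normrN.
by apply/nbhs_normP; exists r => // z; rewrite /= sub0r normrN; exact: h.
Qed.

Lemma cvg_norm_le (K : numFieldType) (V : normedModType K) (u : nat -> V) (l : V) (M : K) :
  u n @[n --> \oo] --> l -> (forall n, `|u n| <= M) -> `|l| <= M.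
Proof.
move=> ul uM.
(* [K] is only partially ordered: [M] must be real to be comparable with [|l|]. *)
have Mr : M \is Num.real by apply: ger0_real; apply: le_trans (uM 0%N).
have [//|Ml] := real_leP (normr_real l) Mr.
have e0 : 0 < `|l| - M by rewrite subr_gt0.
have /cvgrPdist_lt/(_ _ e0) [N _ /(_ N (leqnn N)) /= lN] := ul.
have := le_lt_trans (lerB_dist _ _) lN.
by rewrite ltrD2l ltrN2 => /lt_le_trans/(_ (uM N)); rewrite ltxx.
Qed.

(* Convergence of the series at one point [p] bounds [|a n| * p ^+ n], so that
   the tail from degree 2 on is dominated by a geometric series. *)
Lemma power_series_linear_approx (K : numFieldType) (f : K -> K) (a : nat -> K) :
  (\forall z \near (0 : K),
     (a 1%N * z + \sum_(2 <= j < n) a j * z ^+ j) @[n --> \oo] --> f z) ->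
  exists2 C : K, 0 < C &
    \forall z \near (0 : K), `|f z - a 1%N * z| <= C * `|z| ^+ 2.
Proof.
move=> /near0_normP[r r0 h].
pose p := r / 2; have p0 : 0 < p by rewrite divr_gt0.
have pr : `|p| < r by rewrite gtr0_norm// ltr_pdivrMr// ltr_pMr// ltr1n.
pose S n := a 1%N * p + \sum_(2 <= j < n) a j * p ^+ j.
have [M M0 SM] : exists2 M : K, 0 < M & forall n, `|S n| <= M.
  apply: (@bounded_fun_norm_le _ K); apply: cvg_seq_bounded; apply/cvg_ex; exists (f p).
  exact: h.
(* Each term is a difference of two consecutive partial sums, both bounded by [M]. *)
have aM n : (2 <= n)%N -> `|a n| * p ^+ n <= M *+ 2.
  move=> n2; have -> : `|a n| * p ^+ n = `|S n.+1 - S n|.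
    by rewrite /S big_nat_recr//= opprD addrACA subrr add0r addrAC subrr add0r
      normrM normrX (gtr0_norm p0).
  by rewrite mulr2n; apply: le_trans (ler_normB _ _) _; rewrite lerD.
exists (M *+ 4 / p ^+ 2); first by rewrite divr_gt0 ?exprn_gt0// pmulrn_lgt0.
(* This radius keeps the ratio [q] of the dominating geometric series at most 1/2. *)
apply/near0_normP; exists (p / 2); first by rewrite divr_gt0.
move=> z zp.
have zr : `|z| < r.
  rewrite gtr0_norm// in pr; apply: lt_trans zp (le_lt_trans _ pr).
  by rewrite ler_pdivrMr// ler_pMr// ler1n.
pose q := `|z| / p.
have q0 : 0 <= q by rewrite divr_ge0 ?(ltW p0).
have q2 : q <= 2^-1 by rewrite ler_pdivrMr// mulrC ltW.
have bnd n : `|\sum_(2 <= j < n) a j * z ^+ j| <= M *+ 4 / p ^+ 2 * `|z| ^+ 2.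
  apply: (@le_trans _ _ (\sum_(2 <= j < n) (M *+ 2) * q ^+ j)).
    apply: le_trans (ler_norm_sum _ _ _) _.
    rewrite !big_nat; apply: ler_sum => j /andP[j2 _].
    rewrite normrM normrX (_ : `|z| = p * q); last by rewrite mulrC divfK// gt_eqF.
    by rewrite exprMn mulrA ler_wpM2r ?exprn_ge0// aM.
  rewrite -mulr_sumr.
  have -> : M *+ 4 / p ^+ 2 * `|z| ^+ 2 = M *+ 2 * (q ^+ 2 *+ 2).
    by rewrite /q; field; rewrite gt_eqF.
  rewrite ler_pM2l ?pmulrn_lgt0//.
  (* The subtracted term makes the induction close, because [2 * q <= 1]; [maxn n 2] covers the
     empty sums. *)
  have : \sum_(2 <= j < n) q ^+ j <= q ^+ 2 *+ 2 - q ^+ (maxn n 2) *+ 2.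
    elim: n => [|n IH]; first by rewrite big_geq// subrr.
    have [n2|n2] := leqP 2 n; last first.
      by rewrite big_geq// (maxn_idPr n2) subrr.
    rewrite big_nat_recr//= (maxn_idPl n2) in IH *.
    rewrite (maxn_idPl (leqW n2)).
    apply: le_trans (lerD IH (lexx _)) _.
    rewrite -addrA lerD2l exprS mulr2n opprD -addrA addNr addr0.
    by rewrite lerN2 -mulrnAl ler_piMl ?exprn_ge0// -mulr_natr -ler_pdivlMr// div1r.
  by move=> /le_trans; apply; rewrite gerBl mulrn_wge0// exprn_ge0.
apply: (@cvg_norm_le K K (fun n => a 1%N * z + \sum_(2 <= j < n) a j * z ^+ j - a 1%N * z)).
  by apply: cvgB (h z zr) _; exact: cvg_cst.
by move=> n; rewrite addrAC subrr add0r.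
Qed.

Lemma near0_linear_contraction (R : realType) (f : R[i] -> R[i]) (a : nat -> R[i]) :
  (\forall z \near (0 : R[i]),
     (a 1%N * z + \sum_(2 <= j < n) a j * z ^+ j) @[n --> \oo] --> f z) ->
  `|a 1%N| < 1 ->
  exists2 l : R, 0 < l < 1 &
    \forall z \near (0 : R[i]), `|f z| <= l%:C * `|z|.
Proof.
move=> /power_series_linear_approx[C C0 h] a1.
pose b := complex.Re `|a 1%N|.
have bE : `|a 1%N| = b%:C by rewrite RRe_real.
have b0 : 0 <= b by rewrite -lecR -bE normr_ge0.
have b1 : b < 1 by rewrite -ltcR -bE.
(* The midpoint of [|a_1|] and 1 leaves a gap [l - b] that absorbs the quadratic error once
   [C * |z| < l - b]. *)
pose l := (b + 1) / 2.
have bl : b < l by rewrite /l; lra.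
exists l; first by rewrite /l; apply/andP; split; lra.
have lb0 : 0 < (l - b)%:C / C by rewrite divr_gt0// ltcR subr_gt0.
near=> z.
have fz : `|f z - a 1%N * z| <= C * `|z| ^+ 2 by near: z.
have zr : `|z| < (l - b)%:C / C.
  by near: z; apply/near0_normP; exists ((l - b)%:C / C).
rewrite -[f z](subrK (a 1%N * z)); apply: le_trans (ler_normD _ _) _.
rewrite normrM bE -[l](subrK b) rmorphD mulrDl lerD2r.
apply: le_trans fz _; rewrite expr2 mulrA ler_wpM2r// mulrC.
by rewrite -ler_pdivlMr// ltW.
Unshelve. all: by end_near.
Qed.

(** Since [l < 1], the iterates never leave the disc on which the one-step bound holds, so that
    bound can be iterated. *)
Lemma near0_orbit_decay (R : realType) (f : R[i] -> R[i]) (l : R) : 0 < l < 1 ->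
  (\forall z \near (0 : R[i]), `|f z| <= l%:C * `|z|) ->
  \forall z \near (0 : R[i]), forall n, `|iter n f z| <= (l ^+ n)%:C * `|z|.
Proof.
move=> /andP[l0 l1] /near0_normP[r r0 h]; apply/near0_normP; exists r => // z zr.
elim=> [|n IH]; first by rewrite expr0 mul1r.
have fr : `|iter n f z| < r.
  apply: le_lt_trans IH (le_lt_trans _ zr).
  by rewrite ler_piMl// lecR exprn_ile1// ltW.
apply: le_trans (h _ fr) _.
by rewrite exprS rmorphM -mulrA ler_pM2l// ltcR.
Qed.

(** * Box dimension of geometrically decaying sequences and of orbits *)

Lemma box_dim_geometric_decay (R : realType) (u : nat -> R[i]) (l r : R) :
  0 < l < 1 -> 0 < r -> (forall n, `|u n| <= (r * l ^+ n)%:C) ->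
  has_box_dim [set u n | n in [set: nat]] 0%E.
Proof.
move=> l01 r0 ur; have /andP[l0 l1] := l01.
pose U := [set u n | n in [set: nat]].
have ratio_ge0 (s e : R) : (0 <= area_ratio U s e)%E.
  by rewrite /area_ratio mule_ge0// inve_ge0 lee_fin powR_ge0.
have ratio_small (s d : R) : 0 < s -> 0 < d ->
    \forall e \near 0^'+, (area_ratio U s e <= d%:E)%E.
  (* The factor 16 comes from the area [16 * e ^+ 2] of a square of side [4 * e]. *)
  move=> s0 d0; have d16 : 0 < d / 16 by rewrite divr_gt0.
  near=> e.
  have e0 : 0 < e by near: e; exact: nbhs_right_gt.
  have [N Ne Nd] : exists2 N, r * l ^+ N < e & N.+1%:R * e `^ s <= d / 16.
    by near: e; exact: near0_geometric_count.
  have uN n : (N <= n)%N -> `|u n| < e%:C.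
    move=> Nn; apply: le_lt_trans (ur n) _; rewrite ltcR; apply: le_lt_trans Ne.
    by rewrite ler_pM2l// ler_wiXn2l// ltW.
  have p0 : 0 < e `^ (2 - s) by rewrite powR_gt0.
  rewrite /area_ratio inver gt_eqF// lee_pdivrMr//.
  apply: le_trans (area_eps_nbhd_range e0 uN) _; rewrite -EFinM lee_fin.
  have ws0 : 0 < e `^ s by rewrite powR_gt0.
  rewrite powRD ?(gt_eqF e0) ?implybT// powRN powR_mulrn ?(ltW e0)//.
  have -> : d * (e ^+ 2 / e `^ s) = d / 16 * (16 * e ^+ 2) / e `^ s.
    by field; rewrite gt_eqF.
  by rewrite ler_pdivlMr// mulrAC ler_pM2r// mulr_gt0// exprn_gt0.
have sup0 (s : R) : 0 < s -> limf_esup (area_ratio U s) 0^'+ = 0%E.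
  by move=> s0; apply: limf_esup_near0 => // d; exact: ratio_small.
have inf0 (s : R) : 0 < s -> limf_einf (area_ratio U s) 0^'+ = 0%E.
  by move=> s0; apply: limf_einf_near0 => // d; exact: ratio_small.
(* The admissible exponents are nonnegative and include every [s > 0], so their infimum is 0 whether
   or not [s = 0] is admissible. This serves both dimensions. *)
have dim0 (P : R -> Prop) : (forall s, 0 < s -> P s) ->
    ereal_inf [set s%:E | s in [set s : R | 0 <= s /\ P s]] = 0%E.
  move=> Ps; apply/eqP; rewrite eq_le; apply/andP; split; last first.
    by apply: le_ereal_inf_tmp => _ [s [s0 _] <-]; rewrite lee_fin.
  apply/lee_addgt0Pr => d d0; rewrite add0e.
  by apply: ereal_inf_lbound; exists d => //; split; [exact: ltW|exact: Ps].
by split; apply: dim0.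
Unshelve. all: by end_near.
Qed.

Theorem proposition3p2 (R : realType) (f : R[i] -> R[i]) (a : nat -> R[i])
  (f_diffeo : holomorphic_diffeo_germ f)
  (f_expansion : \forall z \near (0 : R[i]),
     (a 1%N * z + \sum_(2 <= j < n) a j * z ^+ j) @[n --> \oo] --> f z)
  (a1_neq0 : 0 < `|a 1%N|)
  (a1_lt1 : `|a 1%N| < 1) :
  \forall z0 \near (0 : R[i]), has_box_dim (orbit_set f z0) 0%E.
Proof.
have [l l01 fl] := near0_linear_contraction f_expansion a1_lt1.
have /andP[/ltW l0 _] := l01.
near=> z.
have zn n : `|iter n f z| <= (l ^+ n)%:C * `|z|.
  by move: n; near: z; exact: near0_orbit_decay l01 fl.
have zE : `|z| = (complex.Re `|z|)%:C by rewrite RRe_real.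
(* Adding 1 to [|z|] keeps the constant positive even for the constant orbit of [z = 0]. *)
apply: (@box_dim_geometric_decay _ _ l (complex.Re `|z| + 1)) => // [|n].
  by rewrite ltr_wpDl// -lecR -zE normr_ge0.
apply: le_trans (zn n) _; rewrite {1}zE -rmorphM lecR mulrC.
by rewrite ler_wpM2r ?lerDl// exprn_ge0.
Unshelve. all: by end_near.
Qed.
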